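(* Let $(\lambda,x_R,x_L)$ be a simple eigentriplet of $A\in\mathbb{C}^{n\times n}$ with $\|x_L\|=\|x_R\|=1$, $\kappa(\lambda)=1/|x_L^*x_R|$, separation $\eta=\operatorname{sep}(\lambda,A_{22})>0$ and adjoint residual norm $\nu(\lambda)=\|(A^*-\bar\lambda I)x_R\|$. Fix $\epsilon\in(0,1)$ and $\beta>0$, and let $$K_\epsilon=\frac{1+\epsilon}{1-\epsilon},\qquad M_\lambda=\nu(\lambda)+(1+\epsilon)\|A-\lambda I\|,\qquad C_{RR}=\sqrt{1+K_\epsilon\|A-\lambda I\|^2/\beta^2}.$$ Consider the randomized Jacobi-Davidson iteration (without restarting) described in the context, with $\theta_m\ne\lambda$ for all $m$, and suppose: (i) the randomized correction equation is solved exactly at each step; (ii) $S$ is an $\epsilon$-subspace embedding for $\operatorname{span}([V_m,AV_m])$ at each step; (iii) the sketched uniform separation condition holds with constant $\beta$; (iv) the initial subspace angle $\rho_0=\sin\angle(x_R,V_0)$ satisfies $\rho_0<\rho_*$, where $$\rho_*:=\frac{(1-\epsilon)\eta}{16\,\kappa(\lambda)M_\lambda C_{RR}^2}.$$ Then, for every $m\ge 0$, the subspace angles $\rho_m=\sin\angle(x_R,V_m)$ contract: $$\rho_{m+1}<\frac{\rho_m^2}{\rho_*},$$ so $\rho_m$ converges (to $0$) at least quadratically; and the Ritz vector angle $s_m=\sin\angle(x_R,u_m)$ satisfies $s_m\le C_{RR}\rho_m$, and it converges at the same rate.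
   Context: Notation: $\|\cdot\|$ is the Euclidean norm of vectors and the spectral norm of matrices. $\operatorname{span}(V)$ is the column space of $V$. For nonzero $x$ and a matrix (or nonzero vector) $W$, $\sin\angle(x,W)=\min_{w\in\operatorname{span}(W)}\|x-w\|/\|x\|$. For $\mu\in\mathbb{C}$ and square $B$, $\operatorname{sep}(\mu,B)=\sigma_{\min}(\mu I-B)$. Eigentriplet: $\lambda$ is a simple eigenvalue of $A$, $Ax_R=\lambda x_R$, $x_L^*A=\lambda x_L^*$. $X_\perp\in\mathbb{C}^{n\times(n-1)}$ has orthonormal columns spanning the complementary invariant subspace $\operatorname{span}(x_L)^\perp$, and $A_{22}=X_\perp^*AX_\perp$, so that $AX_\perp=X_\perp A_{22}$. Sketching: $S\in\mathbb{C}^{s\times n}$ is an $\epsilon$-subspace embedding for a subspace $\mathcal V\subset\mathbb{C}^n$ if $(1-\epsilon)\|u\|^2\le\|Su\|^2\le(1+\epsilon)\|u\|^2$ for all $u\in\mathcal V$. A matrix $V$ is sketch-orthonormal if $(SV)^*(SV)=I$. $x\perp_S y$ means $(Sx)^*(Sy)=0$. Iteration: $S$ is fixed and $V_0$ is sketch-orthonormal. At step $m\ge0$, given the sketch-orthonormal $V_m$, put $H_m=(SV_m)^*(SAV_m)$; select an eigenpair $(\theta_m,y_m)$ of $H_m$ with $\|y_m\|=1$ (in the algorithm, the one whose eigenvalue is closest to a prescribed target) to target $(\lambda,x_R)$; set $u_m=V_my_m$ (so $\|Su_m\|=1$) and $r_m=Au_m-\theta_mu_m$. With $\Pi_{u_m}^S=I-u_m(Su_m)^*S$,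 solve the randomized correction equation $$\Pi_{u_m}^S(A-\theta_mI)\Pi_{u_m}^S t_m=-\Pi_{u_m}^S r_m,\qquad t_m\perp_S u_m,$$ for $t_m$; and let $V_{m+1}$ be a sketch-orthonormal basis of $\operatorname{span}([V_m,t_m])$, extending $V_m$. Uniform separation condition with constant $\beta>0$: for every $m$, extending $y_m$ to a unitary matrix $[y_m,Y_\perp]$ and writing $$[y_m,Y_\perp]^*H_m[y_m,Y_\perp]=\begin{bmatrix}\theta_m&H_{12}\\0&H_{22}\end{bmatrix},$$ one has $\sigma_{\min}(H_{22}-\lambda I)\ge\beta$. *)

(* Defs.v *)
From mathcomp Require Export all_boot all_order all_algebra.
From mathcomp Require Export complex.
From mathcomp Require Export boolp classical_sets reals constructive_ereal ereal.
From mathcomp Require Export topology normedtype sequences.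

Set Implicit Arguments.
Unset Strict Implicit.
Unset Printing Implicit Defensive.

Export Order.TTheory GRing.Theory Num.Theory.
Export numFieldNormedType.Exports.

Local Open Scope classical_set_scope.
Local Open Scope ring_scope.
Local Open Scope complex_scope.
Local Open Scope sesquilinear_scope.

Section LinearAlgebra.
Variable R : realType.
Local Notation C := R[i].

(* The library norm of R[i] takes values in R[i]; modulus takes values in R. *)
Definition modulus (z : C) : R := complex.Re `|z|.

Definition enorm n (x : 'cV[C]_n) : R :=
  Num.sqrt (\sum_(i < n) modulus (x i 0) ^+ 2).

Definition colspan n k (W : 'M[C]_(n, k)) : set 'cV[C]_n :=
  range (fun c : 'cV[C]_k => W *m c).

(* The infimum is attained, since the column space is closed. *)
Definition sin_angle n k (x : 'cV[C]_n) (W : 'M[C]_(n, k)) : R :=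
  inf [set enorm (x - w) / enorm x | w in colspan W].

Definition singular_values m n (B : 'M[C]_(m, n)) : set R :=
  [set s | 0 <= s /\ eigenvalue (B^t* *m B) (s ^+ 2)%:C].

Definition spectral_norm m n (B : 'M[C]_(m, n)) : R := sup (singular_values B).

(* Extended-real valued, so that the smallest singular value of a 0 x 0 matrix
   is +oo and a lower bound on it is no constraint. *)
Definition sigma_min n (B : 'M[C]_n) : \bar R :=
  ereal_inf [set s%:E | s in singular_values B].

Definition sep n (mu : C) (B : 'M[C]_n) : \bar R := sigma_min (mu%:M - B).

Definition simple_eigenvalue n (A : 'M[C]_n) (lambda : C) : Prop :=
  mup lambda (char_poly A) = 1%N.

Definition eigentriplet n (A : 'M[C]_n) (lambda : C) (xR xL : 'cV[C]_n) : Prop :=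
  [/\ simple_eigenvalue A lambda,
      xR != 0, xL != 0,
      A *m xR = lambda *: xR
    & xL^t* *m A = lambda *: xL^t*].

Definition orthonormal_basis_of n k (X : 'M[C]_(n, k)) (E : set 'cV[C]_n) : Prop :=
  X^t* *m X = 1%:M /\ colspan X = E.

Definition orthogonal_to n (x : 'cV[C]_n) : set 'cV[C]_n :=
  [set z | x^t* *m z = 0].

End LinearAlgebra.

Section Sketching.
Variables (R : realType) (s n : nat) (S : 'M[R[i]]_(s, n)).
Local Notation C := R[i].

Definition subspace_embedding (eps : R) (E : set 'cV[C]_n) : Prop :=
  forall u, E u ->
    (1 - eps) * enorm u ^+ 2 <= enorm (S *m u) ^+ 2 <= (1 + eps) * enorm u ^+ 2.

Definition sketch_orthonormal k (V : 'M[C]_(n, k)) : Prop :=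
  (S *m V)^t* *m (S *m V) = 1%:M.

Definition sketch_orthogonal (x y : 'cV[C]_n) : Prop :=
  (S *m x)^t* *m (S *m y) = 0.

Definition sketch_projector (u : 'cV[C]_n) : 'M[C]_n :=
  1%:M - u *m (S *m u)^t* *m S.

Definition sketched_rayleigh (A : 'M[C]_n) k (V : 'M[C]_(n, k)) : 'M[C]_k :=
  (S *m V)^t* *m (S *m A *m V).

End Sketching.

Section Iteration.
Variables (R : realType) (s n : nat) (S : 'M[R[i]]_(s, n)) (A : 'M[R[i]]_n).
Local Notation C := R[i].

Definition unit_eigenpair k (H : 'M[C]_k) (theta : C) (y : 'cV[C]_k) : Prop :=
  H *m y = theta *: y /\ enorm y = 1.

Definition solves_correction (u : 'cV[C]_n) (theta : C) (t : 'cV[C]_n) : Prop :=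
  let P := sketch_projector S u in
  let r := A *m u - theta *: u in
  P *m (A - theta%:M) *m P *m t = - (P *m r) /\ sketch_orthogonal S t u.

(* V' need not have more columns than V: the dimension is unchanged when t
   already lies in the column space of V. *)
Definition sketch_extension k k' (V : 'M[C]_(n, k)) (t : 'cV[C]_n)
    (V' : 'M[C]_(n, k')) : Prop :=
  [/\ sketch_orthonormal S V',
      colspan V' = colspan (row_mx V t),
      (k <= k')%N
    & forall (i : 'I_n) (j : 'I_k) (j' : 'I_k'),
        j = j' :> nat -> V' i j' = V i j].

(* One exact step V -> V' of the iteration; p.+1 and q.+1 are the dimensions of
   the search subspaces, which are nonzero since H has an eigenvector. *)
Record rjd_step p q (V : 'M[C]_(n, p.+1)) (theta : C) (y : 'cV[C]_p.+1)
    (t : 'cV[C]_n) (V' : 'M[C]_(n, q.+1)) : Prop := RJDStep {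
  rjd_ritz : unit_eigenpair (sketched_rayleigh S A V) theta y;
  rjd_correction : solves_correction (V *m y) theta t;
  rjd_expansion : sketch_extension V t V'
}.

(* The singular values of H22 - lambda I do not depend on the unitary completion
   Y of y, so it does not matter that one completion is taken. *)
Definition separated p (lambda : C) (beta : R) (V : 'M[C]_(n, p.+1)) (theta : C)
    (y : 'cV[C]_p.+1) : Prop :=
  exists (Y : 'M[C]_(p.+1, p)) (H12 : 'rV[C]_p) (H22 : 'M[C]_p),
    let Q : 'M[C]_p.+1 := row_mx y Y in
    [/\ Q \is unitarymx,
        Q^t* *m sketched_rayleigh S A V *m Q
          = block_mx theta%:M H12 0 H22 :> 'M[C]_(1 + p)
      & (beta%:E <= sigma_min (H22 - lambda%:M))%E].

End Iteration.

Definition quadratic_convergence_to_0 (R : realType) (u : nat -> R) : Prop :=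
  (u @ \oo --> (0 : R)) /\ exists c : R, forall m, u m.+1 <= c * u m ^+ 2.

(* Main.v *)
(* Solving the correction equation exactly puts w = u + t with
   (A - theta I) w = alpha u into the next search space, so each step contains
   one step of inverse iteration.  Split along the eigenvector x and the
   complementary invariant subspace span X.  The component of a multiple of u
   along X is at most 2 kappa e, where e = |x - a u|, and inverse iteration
   multiplies it, relative to the component along x, by at most
   |theta - lambda| / (eta - |theta - lambda|).  Since |theta - lambda| is itself
   at most of order e, the new angle is of order e^2; and e is at most CRR times
   the angle rho between x and the search space, by the Rayleigh-Ritz estimate.
   The constant 16 in rho_* leaves room for these crude bounds.  The contraction
   is strict because rho = 0 would make lambda an eigenvalue of H, and the
   separation condition would then force theta = lambda.  A vanishing xL^* x
   would give rho_* = 0, as x / 0 = 0, hence is excluded by rho_0 < rho_*. *)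
Require Import Defs.
From mathcomp Require Import ring lra.
Set Implicit Arguments.
Unset Strict Implicit.
Unset Printing Implicit Defensive.
Local Open Scope classical_set_scope.
Local Open Scope ring_scope.
Local Open Scope complex_scope.
Local Open Scope sesquilinear_scope.

(** * The real-valued modulus of complex numbers *)

Section Modulus.
Variable R : realType.
Implicit Types z w : R[i].

Lemma modulusE z : (modulus z)%:C = `|z|.
Proof. by rewrite /modulus RRe_real ?normr_real. Qed.

Lemma modulus_ge0 z : 0 <= modulus z.
Proof. by rewrite -ler0c modulusE. Qed.

Lemma modulusM z w : modulus (z * w) = modulus z * modulus w.
Proof. by apply: complexI; rewrite rmorphM /= !modulusE normrM. Qed.

Lemma modulusN z : modulus (- z) = modulus z.
Proof. by rewrite /modulus normrN. Qed.

Lemma modulus1 : modulus (1 : R[i]) = 1.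
Proof. by rewrite /modulus normr1. Qed.

Lemma modulus_eq0 z : (modulus z == 0) = (z == 0).
Proof. by rewrite -(inj_eq (@complexI R)) modulusE normr_eq0. Qed.

Lemma modulus_gt0 z : (0 < modulus z) = (z != 0).
Proof. by rewrite lt0r modulus_eq0 modulus_ge0 andbT. Qed.

Lemma modulus_le_add z w : modulus (z + w) <= modulus z + modulus w.
Proof. by rewrite -lecR rmorphD /= !modulusE ler_normD. Qed.

Lemma modulus_ge_sub z w : modulus z - modulus w <= modulus (z - w).
Proof. by rewrite lerBlDr -{1}(subrK w z) modulus_le_add. Qed.

End Modulus.

(** * Euclidean norm, isometries and orthogonal projection *)

Section EuclideanNorm.
Variable R : realType.
Local Notation C := R[i].

Lemma enorm_ge0 n (x : 'cV[C]_n) : 0 <= enorm x.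
Proof. exact: sqrtr_ge0. Qed.

Lemma enorm_sqr n (x : 'cV[C]_n) : enorm x ^+ 2 = \sum_i modulus (x i 0) ^+ 2.
Proof. by rewrite sqr_sqrtr // sumr_ge0 // => i _; rewrite sqr_ge0. Qed.

Lemma enorm_gram n (x : 'cV[C]_n) : (enorm x ^+ 2)%:C = (x^t* *m x) 0 0.
Proof.
rewrite enorm_sqr mxE rmorph_sum; apply: eq_bigr => i _ /=.
by rewrite !mxE rmorphXn /= modulusE normCK mulrC.
Qed.

Lemma enorm_sqr_eq m n (x : 'cV[C]_m) (y : 'cV[C]_n) :
  x^t* *m x = y^t* *m y -> enorm x = enorm y.
Proof.
move=> xy; apply/eqP; rewrite -(@eqrXn2 _ 2) ?enorm_ge0 //; apply/eqP.
by apply: complexI; rewrite !enorm_gram xy.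
Qed.

(** Bridge to the Hermitian form [dotmx] on rows, through which the triangle and Cauchy-Schwarz
    inequalities are imported. *)
Lemma enorm_sqrtC n (x : 'cV[C]_n) : (enorm x)%:C = sqrtC (dotmx (x^t*) (x^t*)).
Proof.
by rewrite dotmxE trmxCK -enorm_gram rmorphXn /= sqrCK // ler0c enorm_ge0.
Qed.

Lemma enormD n (x y : 'cV[C]_n) : enorm (x + y) <= enorm x + enorm y.
Proof.
rewrite -lecR rmorphD /= !enorm_sqrtC.
have -> : (x + y)^t* = x^t* + y^t* by rewrite linearD /= map_mxD.
exact: (triangle_lerif (@dotmx _ n)).
Qed.

Lemma cauchy_schwarz n (x y : 'cV[C]_n) :
  modulus ((x^t* *m y) 0 0) <= enorm x * enorm y.
Proof.
rewrite -lecR rmorphM /= !enorm_sqrtC modulusE.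
have -> : (x^t* *m y) 0 0 = dotmx (x^t*) (y^t*) by rewrite dotmxE trmxCK.
exact: (CauchySchwarz_sqrt (@dotmx _ n)).
Qed.

Lemma enormZ n a (x : 'cV[C]_n) : enorm (a *: x) = modulus a * enorm x.
Proof.
apply/eqP; rewrite -(@eqrXn2 _ 2) ?enorm_ge0 ?mulr_ge0 ?modulus_ge0 ?enorm_ge0 //.
rewrite exprMn !enorm_sqr mulr_sumr; apply/eqP; apply: eq_bigr => i _.
by rewrite mxE modulusM exprMn.
Qed.

Lemma enormN n (x : 'cV[C]_n) : enorm (- x) = enorm x.
Proof. by rewrite -scaleN1r enormZ modulusN modulus1 mul1r. Qed.

Lemma enormB n (x y : 'cV[C]_n) : enorm (x - y) <= enorm x + enorm y.
Proof. by rewrite -(enormN y) enormD. Qed.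

Lemma enorm_ge_sub n (x y : 'cV[C]_n) : enorm x - enorm y <= enorm (x - y).
Proof. by rewrite lerBlDr -{1}(subrK y x) enormD. Qed.

Lemma enorm_eq0 n (x : 'cV[C]_n) : (enorm x == 0) = (x == 0).
Proof.
apply/eqP/eqP => [x0|->]; last first.
  by rewrite -(scale0r 0) enormZ /modulus normr0 mul0r.
have := enorm_sqr x; rewrite x0 expr0n /= => /esym/eqP.
rewrite psumr_eq0 => [/allP x0'|i _]; last exact: sqr_ge0.
apply/colP => i; rewrite mxE; apply/eqP; rewrite -modulus_eq0 -sqrf_eq0.
exact: x0' (mem_index_enum i).
Qed.

Lemma enorm_gt0 n (x : 'cV[C]_n) : (0 < enorm x) = (x != 0).
Proof. by rewrite lt0r enorm_eq0 enorm_ge0 andbT. Qed.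

Lemma enorm_isometry m n (W : 'M[C]_(m, n)) x :
  W^t* *m W = 1%:M -> enorm (W *m x) = enorm x.
Proof.
move=> W1; apply: enorm_sqr_eq.
by rewrite trmx_mul map_mxM mulmxA -[_ *m W]mulmxA W1 mulmx1.
Qed.

(** For z the adjoint of W applied to x, |z|^2 is the inner product of x with W z, hence at most |x|
    |z|; divide by |z|. *)
Lemma enorm_adj_isometry m n (W : 'M[C]_(m, n)) x :
  W^t* *m W = 1%:M -> enorm (W^t* *m x) <= enorm x.
Proof.
move=> W1; set z := W^t* *m x.
have := enorm_ge0 z; rewrite le_eqVlt => /predU1P[<-|z0]; first exact: enorm_ge0.
rewrite -(ler_pM2r z0) -expr2.
have -> : enorm z ^+ 2 = modulus ((x^t* *m (W *m z)) 0 0).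
  apply: complexI; rewrite modulusE mulmxA.
  have -> : x^t* *m W = z^t* by rewrite trmx_mul map_mxM trmxCK.
  by rewrite -enorm_gram ger0_norm // ler0c sqr_ge0.
by apply: le_trans (cauchy_schwarz _ _) _; rewrite enorm_isometry.
Qed.

Lemma enorm_col_mx m n (x : 'cV[C]_m) (y : 'cV[C]_n) :
  enorm (col_mx x y) ^+ 2 = enorm x ^+ 2 + enorm y ^+ 2.
Proof.
rewrite !enorm_sqr big_split_ord /=; congr (_ + _); apply: eq_bigr => i _.
  by rewrite col_mxEu.
by rewrite col_mxEd.
Qed.

Lemma enorm_col_mx_ge m n (x : 'cV[C]_m) (y : 'cV[C]_n) :
  enorm y <= enorm (col_mx x y).
Proof.
rewrite -(@ler_pXn2r _ 2) ?nnegrE ?enorm_ge0 //.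
by rewrite enorm_col_mx lerDr sqr_ge0.
Qed.

Lemma enorm_pythagoras n (x y : 'cV[C]_n) :
  x^t* *m y = 0 -> enorm (x + y) ^+ 2 = enorm x ^+ 2 + enorm y ^+ 2.
Proof.
move=> xy; have yx : y^t* *m x = 0.
  by rewrite -[y^t* *m x]trmxCK trmx_mul map_mxM trmxCK xy trmx0 map_mx0.
apply: complexI; rewrite rmorphD /= !enorm_gram.
have -> : (x + y)^t* = x^t* + y^t* by rewrite linearD /= map_mxD.
by rewrite mulmxDl !mulmxDr xy yx addr0 add0r [LHS]mxE.
Qed.

(** Normal equations: if [G] kills z then |V z|^2 = 0, so injectivity of [V] makes the Gram matrix
    [G] invertible. *)
Lemma orthogonal_residual n k (V : 'M[C]_(n, k)) (x : 'cV[C]_n) :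
  (forall z : 'cV_k, V *m z = 0 -> z = 0) ->
  exists c : 'cV_k, V^t* *m (x - V *m c) = 0.
Proof.
move=> Vinj; set G := V^t* *m V.
have Gu : G \in unitmx.
  rewrite -unitmx_tr -row_free_unit; apply: inj_row_free => v vG.
  have Gv : G *m v^T = 0 by rewrite -[G]trmxK -trmx_mul vG trmx0.
  suff /(congr1 trmx) : v^T = 0 by rewrite trmxK trmx0.
  apply: Vinj; apply/eqP; rewrite -enorm_eq0 -sqrf_eq0.
  rewrite -(inj_eq (@complexI R)) enorm_gram trmx_mul map_mxM.
  by rewrite -!mulmxA [X in _ *m X]mulmxA Gv mulmx0 mxE.
exists (invmx G *m (V^t* *m x)).
by rewrite mulmxBr mulmxA -/G mulmxA mulmxV // mul1mx subrr.
Qed.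

End EuclideanNorm.

(** * The sine of an angle as a distance to a subspace *)

Section SinAngle.
Variables (R : realType) (n k : nat) (V : 'M[R[i]]_(n, k)) (x : 'cV[R[i]]_n).
Hypothesis x1 : enorm x = 1.

Lemma sin_angle_le c : sin_angle x V <= enorm (x - V *m c).
Proof.
apply: ge_inf; first by exists 0 => _ [w _ <-]; rewrite divr_ge0 ?enorm_ge0.
by exists (V *m c); [exists c|rewrite x1 divr1].
Qed.

Lemma le_sin_angle r : (forall c, r <= enorm (x - V *m c)) -> r <= sin_angle x V.
Proof.
move=> hr; apply: lb_le_inf.
  by exists (enorm (x - V *m 0) / enorm x), (V *m 0) => //; exists 0.
by move=> _ [_ [c _ <-] <-]; rewrite x1 divr1.
Qed.

Lemma sin_angle_ge0 : 0 <= sin_angle x V.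
Proof. by apply: le_sin_angle => c; exact: enorm_ge0. Qed.

(** By Pythagoras, any competitor V z adds |V (c - z)|^2 to the squared orthogonal residual. Only
    injectivity is assumed, because a sketch-orthonormal basis need not be orthonormal. *)
Lemma sin_angle_attained :
  (forall z : 'cV_k, V *m z = 0 -> z = 0) ->
  exists2 c : 'cV_k, V^t* *m (x - V *m c) = 0 & sin_angle x V = enorm (x - V *m c).
Proof.
move=> Vinj; have [c cV] := orthogonal_residual x Vinj; exists c => //.
apply/eqP; rewrite eq_le sin_angle_le; apply: le_sin_angle => z.
rewrite -(@ler_pXn2r _ 2) ?nnegrE ?enorm_ge0 //.
have -> : x - V *m z = (x - V *m c) + V *m (c - z).
  by rewrite mulmxBr addrA subrK.
rewrite [leRHS]enorm_pythagoras ?lerDl ?sqr_ge0 // mulmxA.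
have -> : (x - V *m c)^t* *m V = (V^t* *m (x - V *m c))^t*.
  by rewrite trmx_mul map_mxM trmxCK.
by rewrite cV trmx0 map_mx0 mul0mx.
Qed.

End SinAngle.

(** Applied with [W] the Ritz coordinate vector, this bounds the subspace angle by the Ritz
    angle. *)
Lemma sin_angle_mul (R : realType) n k l (V : 'M[R[i]]_(n, k)) (W : 'M_(k, l)) x :
  enorm x = 1 -> sin_angle x V <= sin_angle x (V *m W).
Proof. by move=> x1; apply: le_sin_angle => // c; rewrite -mulmxA sin_angle_le. Qed.

(** * Norm estimates from singular values *)

Section SingularValues.
Variable R : realType.
Local Notation C := R[i].

Lemma singular_vector m n (B : 'M[C]_(m, n)) s : singular_values B s ->
  exists2 v : 'cV_n, v != 0 & enorm (B *m v) = s * enorm v.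
Proof.
move=> [s0 /eigenvalueP[v vB v0]]; exists (v^t*).
  apply: contra v0 => /eqP /(congr1 (fun M => M^t*)).
  by rewrite trmxCK trmx0 map_mx0 => ->.
apply/eqP; rewrite -(@eqrXn2 _ 2) ?enorm_ge0 ?mulr_ge0 ?enorm_ge0 //; apply/eqP.
apply: complexI; rewrite exprMn [RHS]rmorphM /= !enorm_gram trmx_mul map_mxM trmxCK.
by rewrite -mulmxA [X in _ *m X]mulmxA mulmxA vB -scalemxAl mxE.
Qed.

(* The rows of [P] are right singular vectors of [B]. *)
Lemma svd_enorm m n (B : 'M[C]_(m, n)) :
  exists (P : 'M_n) (d : 'I_n -> R),
    [/\ P^t* *m P = 1%:M, forall i, singular_values B (d i)
      & forall x, enorm (B *m x) ^+ 2
                  = \sum_i d i ^+ 2 * modulus ((P *m x) i 0) ^+ 2].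
Proof.
set G := B^t* *m B; set P := spectralmx G.
have Pu : P \is unitarymx by exact: spectral_unitarymx.
have PV : P *m P^t* = 1%:M by exact/unitarymxP.
have VP : P^t* *m P = 1%:M by exact: mulmx1C.
have GE : G = P^t* *m diag_mx (spectral_diag G) *m P.
  rewrite -invmx_unitary //; apply/orthomx_spectralP/hermitian_normalmx.
  apply/is_hermitianmxP; rewrite expr0 scale1r.
  by rewrite /G trmx_mul map_mxM trmxCK.
have gramE x : (enorm (B *m x) ^+ 2)%:C
    = \sum_i spectral_diag G 0 i * (modulus ((P *m x) i 0) ^+ 2)%:C.
  rewrite enorm_gram trmx_mul map_mxM -mulmxA [X in _ *m X]mulmxA -/G [in LHS]GE.
  have -> : x^t* *m (P^t* *m diag_mx (spectral_diag G) *m P *m x)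
      = (P *m x)^t* *m (diag_mx (spectral_diag G) *m (P *m x)).
    by rewrite trmx_mul map_mxM !mulmxA.
  move: (P *m x) => q; rewrite mxE; apply: eq_bigr => i _.
  by rewrite mul_diag_mx !mxE rmorphXn /= modulusE normCK mulrCA [_^* * _]mulrC.
have rowP i : P *m (row i P)^t* = delta_mx i 0.
  apply/colP => j; have /matrixP/(_ j i) := PV; rewrite !mxE eqxx andbT => <-.
  by apply: eq_bigr => k _; rewrite !mxE.
(* The eigenvalues of [G] are a priori complex; evaluating the quadratic form at the i-th singular
   vector shows that they are squares of real norms, which then serve as the [d i]. *)
have dE i : spectral_diag G 0 i = (enorm (B *m (row i P)^t* ) ^+ 2)%:C.
  rewrite gramE rowP (bigD1 i) //= big1 => [|j ji].
    by rewrite !mxE !eqxx modulus1 expr1n mulr1 addr0.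
  by rewrite !mxE (negPf ji) /modulus normr0 expr0n mulr0.
exists P, (fun i => enorm (B *m (row i P)^t* )); split => //.
  move=> i; split; first exact: enorm_ge0.
  apply/eigenvalueP; exists (row i P).
    rewrite -/G GE !mulmxA -row_mul PV row1 -dE.
    by rewrite -rowE row_diag_mx -scalemxAl -rowE.
  apply/eqP => i0; have /colP/(_ i) := rowP i.
  rewrite i0 trmx0 map_mx0 mulmx0 !mxE !eqxx /= => /esym/eqP.
  by rewrite oner_eq0.
move=> x; apply: complexI; rewrite gramE rmorph_sum; apply: eq_bigr => i _.
by rewrite [RHS]rmorphM /= dE.
Qed.

(** Makes the supremum in [spectral_norm] a genuine one; the sum of all [d i] is a crude bound. *)
Lemma has_ubound_singular_values m n (B : 'M[C]_(m, n)) :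
  has_ubound (singular_values B).
Proof.
have [P [d [PP dB BE]]] := svd_enorm B.
have d0 i : 0 <= d i by case: (dB i).
exists (\sum_i d i) => s sB; have [v v0 Bv] := singular_vector sB.
have s0 : 0 <= s by case: sB.
rewrite -(@ler_pM2r _ (enorm v)) ?enorm_gt0 // -Bv.
rewrite -(@ler_pXn2r _ 2) ?nnegrE ?mulr_ge0 ?enorm_ge0 ?sumr_ge0 //.
rewrite BE exprMn -(enorm_isometry v PP) enorm_sqr mulr_sumr.
apply: ler_sum => i _; rewrite ler_wpM2r ?sqr_ge0 //.
rewrite ler_pXn2r ?nnegrE ?sumr_ge0 // (bigD1 i) //= lerDl sumr_ge0 //.
Qed.

Lemma spectral_norm_ge0 m n (B : 'M[C]_(m, n)) : 0 <= spectral_norm B.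
Proof.
rewrite /spectral_norm.
have [->|/set0P[s sB]] := eqVneq (singular_values B) set0; first by rewrite sup0.
by apply: le_trans (ub_le_sup (has_ubound_singular_values B) sB); case: sB.
Qed.

Lemma spectral_norm_enorm m n (B : 'M[C]_(m, n)) x :
  enorm (B *m x) <= spectral_norm B * enorm x.
Proof.
have [P [d [PP dB BE]]] := svd_enorm B.
have d0 i : 0 <= d i by case: (dB i).
rewrite -(@ler_pXn2r _ 2) ?nnegrE ?mulr_ge0 ?enorm_ge0 ?spectral_norm_ge0 //.
rewrite BE exprMn -(enorm_isometry x PP) enorm_sqr mulr_sumr.
apply: ler_sum => i _; rewrite ler_wpM2r ?sqr_ge0 //.
rewrite ler_pXn2r ?nnegrE ?spectral_norm_ge0 //.
by apply: ub_le_sup; [exact: has_ubound_singular_values | exact: dB].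
Qed.

Lemma sigma_min_enorm n (B : 'M[C]_n) r x : 0 <= r -> (r%:E <= sigma_min B)%E ->
  r * enorm x <= enorm (B *m x).
Proof.
move=> r0 rB; have [P [d [PP dB BE]]] := svd_enorm B.
rewrite -(@ler_pXn2r _ 2) ?nnegrE ?mulr_ge0 ?enorm_ge0 //.
rewrite BE exprMn -(enorm_isometry x PP) enorm_sqr mulr_sumr.
apply: ler_sum => i _; rewrite ler_wpM2r ?sqr_ge0 //.
have rd : r <= d i.
  rewrite -lee_fin; apply: le_trans rB _; apply: ereal_inf_lbound.
  by exists (d i).
by rewrite ler_pXn2r ?nnegrE // (le_trans r0).
Qed.

(** The infimum over an empty set is +oo, so a finite value forces a positive dimension. *)
Lemma sigma_min_fin_nonzero n (B : 'M[C]_n) r :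
  sigma_min B = r%:E -> exists v : 'cV[C]_n, v != 0.
Proof.
rewrite /sigma_min.
have [->|/set0P[s /singular_vector[v v0 _]]] := eqVneq (singular_values B) set0.
  by rewrite image_set0 ereal_inf0.
by exists v.
Qed.

End SingularValues.

(** * Rayleigh-Ritz extraction in the sketched inner product *)

Section RayleighRitz.
Variables (R : realType) (s n p : nat).
Variables (S : 'M[R[i]]_(s, n)) (A : 'M[R[i]]_n) (V : 'M[R[i]]_(n, p.+1)).
Local Notation C := R[i].
Local Notation H := (sketched_rayleigh S A V).
Implicit Types (z : 'cV[C]_p.+1) (lambda theta : C) (beta eps : R).

Hypothesis Vorth : sketch_orthonormal S V.

Lemma enorm_sketch z : enorm (S *m (V *m z)) = enorm z.
Proof. by rewrite mulmxA enorm_isometry. Qed.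

Lemma sketch_orthonormal_inj z : V *m z = 0 -> z = 0.
Proof.
by move=> Vz; apply/eqP; rewrite -enorm_eq0 -enorm_sketch Vz mulmx0 enorm_eq0.
Qed.

Lemma sketched_rayleigh_residual lambda z :
  H *m z - lambda *: z = (S *m V)^t* *m (S *m ((A - lambda%:M) *m (V *m z))).
Proof.
rewrite mulmxBl mulmxBr mulmxBr mul_scalar_mx; congr (_ - _).
  by rewrite /sketched_rayleigh !mulmxA.
by rewrite -!scalemxAr [S *m (V *m z)]mulmxA mulmxA Vorth mul1mx.
Qed.

(** In the basis [Q] the lower block of (H - lambda) z is (H22 - lambda) d, with d the coordinates
    of z along [Y]. Removing the [y]-component of z leaves a vector of norm |d|. *)
Lemma separated_split lambda beta theta y z : 0 < beta ->
  separated S A lambda beta V theta y ->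
  exists a, beta * enorm (z - a *: y) <= enorm (H *m z - lambda *: z).
Proof.
move=> beta0 [Y [H12 [H22]]]; set Q : 'M_p.+1 := row_mx y Y => -[Qu QH sepH].
have QV : Q *m Q^t* = 1%:M by exact/unitarymxP.
have VQ : Q^t* *m Q = 1%:M by exact: mulmx1C.
pose g : 'cV_(1 + p) := Q^t* *m z.
have zE : z = Q *m g by rewrite /g mulmxA QV mul1mx.
have gE : g = col_mx (usubmx g) (dsubmx g) by rewrite vsubmxK.
have mulQ (c : 'cV_1) d : Q *m (col_mx c d : 'cV_(1 + p)) = y *m c + Y *m d.
  exact: (@mul_row_col _ p.+1 1 p 1 y Y c d).
exists (usubmx g 0 0).
have -> : z - usubmx g 0 0 *: y = Q *m (col_mx 0 (dsubmx g) : 'cV_(1 + p)).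
  rewrite {1}zE gE !mulQ mulmx0 add0r col_mxKu col_mxKd.
  by rewrite {1}[usubmx g]mx11_scalar mul_mx_scalar addrAC subrr add0r.
rewrite enorm_isometry //.
have -> : enorm (col_mx 0 (dsubmx g) : 'cV_(1 + p)) = enorm (dsubmx g).
  apply/eqP; rewrite -(@eqrXn2 _ 2) ?enorm_ge0 // enorm_col_mx.
  have /eqP -> : enorm (0 : 'cV[C]_1) == 0 by rewrite enorm_eq0.
  by rewrite expr0n add0r.
apply: (le_trans (sigma_min_enorm _ (ltW beta0) sepH)).
have -> : enorm (H *m z - lambda *: z) = enorm (Q^t* *m (H *m z - lambda *: z)).
  by rewrite enorm_isometry ?trmxCK.
have -> : Q^t* *m (H *m z - lambda *: z)
    = (block_mx theta%:M H12 0 H22 : 'M_(1 + p)) *m g - lambda *: g.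
  by rewrite -QH mulmxBr -scalemxAr -/g {1}zE !mulmxA.
rewrite {2 3}gE mul_block_col scale_col_mx opp_col_mx add_col_mx mul0mx add0r.
rewrite mulmxBl mul_scalar_mx.
exact: (@enorm_col_mx_ge _ 1 p _ _).
Qed.

Variables (lambda : C) (x : 'cV[C]_n) (eps : R).
Hypothesis Ax : A *m x = lambda *: x.
Hypothesis eps01 : 0 < eps < 1.
Hypothesis embS : subspace_embedding S eps (colspan (row_mx V (A *m V))).
Local Notation N := (spectral_norm (A - lambda%:M)).

Lemma embedding_enorm_le z : Num.sqrt (1 - eps) * enorm (V *m z) <= enorm z.
Proof.
have /andP[eps0 eps1] := eps01.
rewrite -(@ler_pXn2r _ 2) ?nnegrE ?mulr_ge0 ?sqrtr_ge0 ?enorm_ge0 //.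
rewrite exprMn sqr_sqrtr ?subr_ge0 ?(ltW eps1) //.
have /andP[+ _] : (1 - eps) * enorm (V *m z) ^+ 2 <= enorm (S *m (V *m z)) ^+ 2
    <= (1 + eps) * enorm (V *m z) ^+ 2.
  by apply: embS; exists (col_mx z 0) => //; rewrite mul_row_col mulmx0 addr0.
by rewrite enorm_sketch.
Qed.

(** Since A - lambda kills [x], it acts on V z as on -(x - V z). The image lies in the span of
    [V, AV], so [S] stretches it by at most sqrt(1 + eps), and the adjoint of S V does not increase
    norms. *)
Lemma sketched_residual_le z :
  enorm (H *m z - lambda *: z)
    <= Num.sqrt (1 + eps) * N * enorm (x - V *m z).
Proof.
have /andP[eps0 eps1] := eps01.
rewrite sketched_rayleigh_residual.
apply: (le_trans (enorm_adj_isometry _ Vorth)).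
have Alx : (A - lambda%:M) *m x = 0 by rewrite mulmxBl Ax mul_scalar_mx subrr.
have -> : (A - lambda%:M) *m (V *m z) = - ((A - lambda%:M) *m (x - V *m z)).
  by rewrite mulmxBr Alx sub0r opprK.
set v := _ *m (x - _).
have /andP[_ Sv] : (1 - eps) * enorm (- v) ^+ 2 <= enorm (S *m - v) ^+ 2
    <= (1 + eps) * enorm (- v) ^+ 2.
  apply: embS; exists (col_mx (- lambda *: z) z) => //.
  rewrite mul_row_col /v mulmxBr Alx sub0r opprK.
  by rewrite mulmxBl mul_scalar_mx -scalemxAr scaleNr addrC mulmxA.
apply: (@le_trans _ _ (Num.sqrt (1 + eps) * enorm v)); last first.
  by rewrite -mulrA ler_wpM2l ?sqrtr_ge0 // spectral_norm_enorm.
rewrite -(@ler_pXn2r _ 2) ?nnegrE ?mulr_ge0 ?sqrtr_ge0 ?enorm_ge0 //.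
by rewrite exprMn (@sqr_sqrtr _ (1 + eps)) ?addr_ge0 ?(ltW eps0) // -(enormN v).
Qed.

Variables (theta : C) (y : 'cV[C]_p.+1) (beta : R).
Hypothesis x1 : enorm x = 1.
Hypothesis beta0 : 0 < beta.
Hypothesis Hy : unit_eigenpair H theta y.
Hypothesis sepH : separated S A lambda beta V theta y.

(** The sketched residual bound at z = a y, where H z - lambda z = a (theta - lambda) y. *)
Lemma ritz_value_error a :
  modulus a * modulus (theta - lambda)
    <= Num.sqrt (1 + eps) * N * enorm (x - V *m (a *: y)).
Proof.
case: Hy => Hy1 y1; apply: le_trans (sketched_residual_le _).
rewrite -scalemxAr Hy1 !scalerA [lambda * a]mulrC -scalerBl -mulrBr.
by rewrite enormZ modulusM y1 mulr1.
Qed.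

(** If x = V c, the sketched residual of c vanishes and separation forces c = a y. The Ritz value
    bound then leaves theta = lambda or a = 0, and the latter would give x = 0. *)
Lemma sin_angle_gt0 : theta <> lambda -> 0 < sin_angle x V.
Proof.
move=> thl; rewrite lt0r sin_angle_ge0 // andbT; apply/eqP => rho0.
have [c _ rhoE] := sin_angle_attained x1 sketch_orthonormal_inj.
have := sketched_residual_le c; rewrite -rhoE rho0 mulr0 => Hc.
have [a] := separated_split c beta0 sepH.
move=> /le_trans/(_ Hc); rewrite pmulr_rle0 // le_eqVlt ltNge enorm_ge0 orbF.
rewrite enorm_eq0 subr_eq0 => /eqP ca.
have := ritz_value_error a; rewrite -ca -rhoE rho0 mulr0.
rewrite le_eqVlt ltNge mulr_ge0 ?modulus_ge0 // orbF mulf_eq0 !modulus_eq0 subr_eq0.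
case/orP => [/eqP a0|/eqP//].
move: rhoE; rewrite rho0 ca a0 scale0r mulmx0 subr0 x1 => /esym/eqP.
by rewrite oner_eq0.
Qed.

(* The Euclidean best approximation [V c] of [x] splits along [y] and a
   complement, whose size the separation bounds by the sketched residual of [c];
   [x - V c] is orthogonal to both parts. *)
Lemma rayleigh_ritz :
  exists a, enorm (x - V *m (a *: y))
    <= Num.sqrt (1 + (1 + eps) / (1 - eps) * N ^+ 2 / beta ^+ 2) * sin_angle x V.
Proof.
have /andP[eps0 eps1] := eps01.
have e1 : 0 < 1 - eps by rewrite subr_gt0.
have e2 : 0 < 1 + eps by rewrite addr_gt0.
have [c cV rhoE] := sin_angle_attained x1 sketch_orthonormal_inj.
have [a ha] := separated_split c beta0 sepH; exists a.
have {}ha := le_trans ha (sketched_residual_le c).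
set b := c - a *: y in ha; have hb := embedding_enorm_le b.
have -> : x - V *m (a *: y) = (x - V *m c) + V *m b.
  by rewrite mulmxBr addrA subrK.
have F0 : 0 <= (1 + eps) / (1 - eps) * N ^+ 2 / beta ^+ 2.
  by rewrite divr_ge0 ?sqr_ge0 // mulr_ge0 ?sqr_ge0 // divr_ge0 // ltW.
rewrite -(@ler_pXn2r _ 2) ?nnegrE ?mulr_ge0 ?enorm_ge0 ?sqrtr_ge0 ?sin_angle_ge0 //.
rewrite enorm_pythagoras; last first.
  have -> : (x - V *m c)^t* *m (V *m b) = (V^t* *m (x - V *m c))^t* *m b.
    by rewrite trmx_mul map_mxM trmxCK mulmxA.
  by rewrite cV trmx0 map_mx0 mul0mx.
rewrite exprMn (sqr_sqrtr (addr_ge0 ler01 F0)) rhoE mulrDl mul1r lerD2l.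
(* It remains to bound q^2. Separation gives beta |b| <= sqrt(1 + eps) N r and the embedding gives
   sqrt(1 - eps) q <= |b|; together they produce the factor (1 + eps) / (1 - eps). *)
move: ha hb; set r := enorm (x - _); set q := enorm (V *m b).
move=> ha hb; have {}ha : beta ^+ 2 * enorm b ^+ 2 <= (1 + eps) * N ^+ 2 * r ^+ 2.
  rewrite -[1 + eps]sqr_sqrtr ?(ltW e2) // -!exprMn.
  rewrite ler_pXn2r ?nnegrE ?mulr_ge0 ?sqrtr_ge0 ?spectral_norm_ge0 ?enorm_ge0 //.
  exact: ltW.
have {}hb : (1 - eps) * q ^+ 2 <= enorm b ^+ 2.
  rewrite -[1 - eps]sqr_sqrtr ?(ltW e1) // -!exprMn.
  by rewrite ler_pXn2r ?nnegrE ?mulr_ge0 ?sqrtr_ge0 ?enorm_ge0.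
have b2 : 0 < beta ^+ 2 by rewrite exprn_gt0.
rewrite -(ler_pM2l b2) -(ler_pM2l e1).
have -> : (1 - eps) * (beta ^+ 2 * ((1 + eps) / (1 - eps) * N ^+ 2 / beta ^+ 2 * r ^+ 2))
   = (1 + eps) * N ^+ 2 * r ^+ 2 by field; rewrite !lt0r_neq0.
by apply: le_trans ha; rewrite mulrCA ler_wpM2l // ltW.
Qed.

End RayleighRitz.

(** * The correction equation as inverse iteration *)

Section CorrectionEquation.
Variables (R : realType) (s n : nat) (S : 'M[R[i]]_(s, n)) (A : 'M[R[i]]_n).

(* The kernel of the sketched projector is spanned by [u], so solving the
   correction equation amounts to one step of inverse iteration. *)
Lemma correction_inverse_iteration theta (u t : 'cV[R[i]]_n) :
  enorm (S *m u) = 1 -> solves_correction S A u theta t ->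
  u + t != 0 /\ exists alpha, (A - theta%:M) *m (u + t) = alpha *: u.
Proof.
move=> Su1 []; rewrite /sketch_projector => Pt tu.
have ut : (S *m u)^t* *m (S *m t) = 0.
  by rewrite -[LHS]trmxCK trmx_mul map_mxM trmxCK tu trmx0 map_mx0.
have uu : (S *m u)^t* *m (S *m u) = 1%:M.
  by rewrite [LHS]mx11_scalar -enorm_gram Su1 expr1n.
split.
  (* The sketched inner product of u with u + t is 1. *)
  apply/eqP => /(congr1 (fun v => (S *m u)^t* *m (S *m v))).
  rewrite mulmxDr mulmxDr uu ut addr0 !mulmx0 => /matrixP/(_ 0 0)/eqP.
  by rewrite !mxE eqxx oner_eq0.
exists (((S *m u)^t* *m (S *m ((A - theta%:M) *m (u + t)))) 0 0).
(* The projector fixes t, so the equation says that it annihilates (A - theta)(u + t); this vector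
   is therefore u times its sketched coefficient along u, the chosen alpha. *)
move: Pt; rewrite -!mulmxA [X in (_ - _) *m ((A - _) *m X)]mulmxBl mul1mx -!mulmxA ut.
rewrite mulmx0 subr0.
have -> : A *m u - theta *: u = (A - theta%:M) *m u by rewrite mulmxBl mul_scalar_mx.
move/eqP; rewrite -addr_eq0 -mulmxDr -mulmxDr [t + u]addrC.
rewrite mulmxBl mul1mx -!mulmxA subr_eq0 => /eqP {1}->.
by rewrite [X in u *m X]mx11_scalar mul_mx_scalar.
Qed.

End CorrectionEquation.

(** * Splitting along the eigenvector and its invariant complement *)

Section ObliqueDecomposition.
Variables (R : realType) (n k : nat) (A : 'M[R[i]]_n).
Variables (lambda : R[i]) (x xL : 'cV[R[i]]_n) (X : 'M[R[i]]_(n, k)).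
Local Notation C := R[i].
Implicit Types (d : 'cV[C]_k) (z : 'cV[C]_n).
Hypothesis Ax : A *m x = lambda *: x.
Hypothesis xLA : xL^t* *m A = lambda *: xL^t*.
Hypothesis x1 : enorm x = 1.
Hypothesis xL1 : enorm xL = 1.
Hypothesis Xbasis : orthonormal_basis_of X (orthogonal_to xL).
Hypothesis xLx : (xL^t* *m x) 0 0 != 0.
Local Notation A22 := (X^t* *m A *m X).
Local Notation kappa := (1 / modulus ((xL^t* *m x) 0 0)).

Lemma complement_orthonormal : X^t* *m X = 1%:M.
Proof. by case: Xbasis. Qed.

Lemma complement_left_orthogonal d : xL^t* *m (X *m d) = 0.
Proof.
case: Xbasis => _ XE; have : colspan X (X *m d) by exists d.
by rewrite XE.
Qed.

Lemma complementP z : xL^t* *m z = 0 -> exists d, z = X *m d.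
Proof.
case: Xbasis => _ XE; rewrite -[_ = 0]/(orthogonal_to xL z) -XE.
by move=> [d _ <-]; exists d.
Qed.

Lemma complement_invariant d : A *m (X *m d) = X *m (A22 *m d).
Proof.
have [|g gE] := @complementP (A *m (X *m d)).
  by rewrite [LHS]mulmxA xLA -scalemxAl complement_left_orthogonal scaler0.
rewrite -!mulmxA gE; congr (_ *m _).
by rewrite mulmxA complement_orthonormal mul1mx.
Qed.

Lemma condition_ge1 : 1 <= kappa.
Proof.
rewrite ler_pdivlMr ?modulus_gt0 // mul1r.
by apply: le_trans (cauchy_schwarz _ _) _; rewrite x1 xL1 mulr1.
Qed.

(** The coefficient c is that of the spectral projector, so z - c x is orthogonal to [xL]. The
    factor 2 comes from |z| + kappa |z|, as kappa >= 1. *)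
Lemma oblique_split z : exists c d,
  [/\ z = c *: x + X *m d, modulus c <= kappa * enorm z
    & enorm d <= 2 * kappa * enorm z].
Proof.
set g := (xL^t* *m x) 0 0; pose c := (xL^t* *m z) 0 0 / g.
have [|d dE] := @complementP (z - c *: x).
  rewrite mulmxBr -scalemxAr [xL^t* *m z]mx11_scalar [xL^t* *m x]mx11_scalar.
  by rewrite -/g scale_scalar_mx divfK // subrr.
have cz : modulus c <= kappa * enorm z.
  have -> : modulus c = kappa * modulus ((xL^t* *m z) 0 0).
    apply: (@mulIf _ (modulus g)); first by rewrite modulus_eq0.
    rewrite -modulusM divfK // mulrAC mul1r mulVf ?mul1r // modulus_eq0 //.
  rewrite ler_wpM2l ?(le_trans ler01 condition_ge1) //.
  by apply: le_trans (cauchy_schwarz _ _) _; rewrite xL1 mul1r.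
exists c, d; split => //; first by rewrite -dE addrC subrK.
rewrite -(enorm_isometry d complement_orthonormal) -dE.
apply: le_trans (enormB _ _) _; rewrite enormZ x1 mulr1.
have : enorm z <= kappa * enorm z by rewrite ler_peMl ?enorm_ge0 // condition_ge1.
by move: cz; set K := kappa * _; rewrite -mulrA -/K; lra.
Qed.

Lemma oblique_split_inj c c' d d' :
  c *: x + X *m d = c' *: x + X *m d' -> c = c' /\ d = d'.
Proof.
move=> cd; have cc : c = c'.
  have /matrixP/(_ 0 0) := congr1 (mulmx (xL^t*)) cd.
  rewrite !mulmxDr !complement_left_orthogonal !addr0 -!scalemxAr !mxE.
  by move/mulIf; apply; move: xLx; rewrite !mxE.
move: cd; rewrite cc => /addrI /(congr1 (mulmx (X^t*))).
by rewrite !mulmxA complement_orthonormal !mul1mx.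
Qed.

Variable eta : R.
Hypothesis eta0 : 0 < eta.
Hypothesis sepA : sep lambda A22 = eta%:E.

Lemma sep_complement d : eta * enorm d <= enorm (lambda *: d - A22 *m d).
Proof.
have -> : lambda *: d - A22 *m d = (lambda%:M - A22) *m d.
  by rewrite mulmxBl mul_scalar_mx.
by apply: sigma_min_enorm; [exact: ltW | rewrite -sepA].
Qed.

(** On the span of [X], A - lambda acts isometrically like A22 - lambda; finiteness of [eta]
    supplies a nonzero test vector. *)
Lemma sep_le_spectral_norm : eta <= spectral_norm (A - lambda%:M).
Proof.
have [d d0] := sigma_min_fin_nonzero sepA.
rewrite -(@ler_pM2r _ (enorm d)) ?enorm_gt0 //.
apply: le_trans (sep_complement d) _.
rewrite -(enorm_isometry _ complement_orthonormal) -(enorm_isometry d complement_orthonormal).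
apply: le_trans _ (spectral_norm_enorm _ _).
rewrite mulmxBl mul_scalar_mx mulmxBr -complement_invariant -scalemxAr.
by rewrite -enormN opprB.
Qed.

(** Write a u = (1 - ce) x - X de and w = c x + X d. Matching components in a (A - theta) w = alpha
    a u gives a c (lambda - theta) = alpha (1 - ce) and a (A22 - theta) d = -alpha de. Eliminating a
    and alpha bounds |d| / |c|. *)
Lemma inverse_iteration_contraction theta alpha a (u w : 'cV[C]_n) :
  let e := enorm (x - a *: u) in let delta := modulus (theta - lambda) in
  theta <> lambda -> delta < eta -> kappa * e < 1 ->
  w != 0 -> (A - theta%:M) *m w = alpha *: u ->
  exists b, (eta - delta) * (1 - kappa * e) * enorm (x - b *: w)
            <= 2 * kappa * e * delta.
Proof.
move=> e delta thl dl ke w0 wE.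
have [ce [de [eE ceb deb]]] := oblique_split (x - a *: u).
have [c [d [wcd _ _]]] := oblique_split w.
have uE : a *: u = (1 - ce) *: x + X *m (- de).
  by rewrite mulmxN scalerBl scale1r -addrA -opprD -eE opprB addrC subrK.
have AwE : (A - theta%:M) *m w = (c * (lambda - theta)) *: x
    + X *m (A22 *m d - theta *: d).
  have xE : (A - theta%:M) *m x = (lambda - theta) *: x.
    by rewrite mulmxBl Ax mul_scalar_mx scalerBl.
  have XE : (A - theta%:M) *m (X *m d) = X *m (A22 *m d - theta *: d).
    by rewrite mulmxBl complement_invariant mul_scalar_mx mulmxBr scalemxAr.
  by rewrite wcd mulmxDr -scalemxAr xE XE scalerA.
have [cE dE] : a * (c * (lambda - theta)) = alpha * (1 - ce)
    /\ a *: (A22 *m d - theta *: d) = alpha *: (- de).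
  apply: oblique_split_inj.
  rewrite -!scalemxAr -(scalerA a) -(scalerA alpha) -!scalerDr -AwE -uE wE.
  by rewrite !scalerA mulrC.
have A22d : (eta - delta) * enorm d <= enorm (A22 *m d - theta *: d).
  have -> : A22 *m d - theta *: d = - (lambda *: d - A22 *m d) - (theta - lambda) *: d.
    by rewrite scalerBl opprB opprB addrA subrK.
  apply: le_trans (enorm_ge_sub _ _); rewrite enormN enormZ mulrBl.
  by rewrite lerB // sep_complement.
have ce1 : 1 - kappa * e <= modulus (1 - ce).
  by apply: le_trans (modulus_ge_sub _ _); rewrite modulus1 lerB.
have ce0 : 0 < modulus (1 - ce) by apply: lt_le_trans ce1; rewrite subr_gt0.
have thl' : modulus (lambda - theta) = delta by rewrite -modulusN opprB.
have delta0 : 0 < delta by rewrite modulus_gt0 subr_eq0; apply/eqP.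
(* For alpha = 0 the vector w would lie in the kernel of A - theta, which is trivial: theta differs
   from lambda, and A22 - theta is bounded below by eta - delta > 0. *)
have alpha0 : alpha != 0.
  apply/eqP => al0; have wz : (A - theta%:M) *m w = 0 *: x + X *m 0.
    by rewrite wE al0 !scale0r mulmx0 addr0.
  move: wz; rewrite AwE => /oblique_split_inj[/eqP].
  rewrite mulf_eq0 -[lambda - theta == 0]modulus_eq0 thl' (gt_eqF delta0) orbF => /eqP c0 d0.
  move: A22d; rewrite d0 (_ : enorm 0 = 0); last by apply/eqP; rewrite enorm_eq0.
  rewrite pmulr_rle0 ?subr_gt0 // le_eqVlt ltNge enorm_ge0 orbF enorm_eq0 => /eqP d1.
  by move: w0; rewrite wcd c0 d1 scale0r mulmx0 addr0 eqxx.
have Mal : 0 < modulus alpha by rewrite modulus_gt0.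
have cE' : modulus a * (modulus c * delta) = modulus alpha * modulus (1 - ce).
  by rewrite -thl' -!modulusM cE.
have ac0 : 0 < modulus a * modulus c.
  by rewrite -(pmulr_lgt0 _ delta0) -mulrA cE' mulr_gt0.
have c0 : c != 0.
  by apply: contraTneq ac0 => ->; rewrite /modulus normr0 mulr0 ltxx.
(* This scaling makes the x-component of b w equal to x, leaving only X d / c. *)
exists c^-1.
have -> : enorm (x - c^-1 *: w) = (modulus c)^-1 * enorm d.
  rewrite wcd scalerDr scalerA mulVf // scale1r opprD addrA subrr add0r enormN.
  rewrite enormZ (enorm_isometry _ complement_orthonormal); congr (_ * _).
  apply: (@mulfI _ (modulus c)); first by rewrite modulus_eq0.
  by rewrite -modulusM !divff ?modulus_eq0 // modulus1.
have dE' : modulus a * ((eta - delta) * enorm d) <= modulus alpha * enorm de.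
  by rewrite -[enorm de]enormN -enormZ -dE enormZ ler_wpM2l ?modulus_ge0.
have Mc : 0 < modulus c by rewrite modulus_gt0.
rewrite -(ler_pM2l ac0).
have -> : modulus a * modulus c *
    ((eta - delta) * (1 - kappa * e) * ((modulus c)^-1 * enorm d))
   = (1 - kappa * e) * (modulus a * ((eta - delta) * enorm d)).
  move: (lt0r_neq0 Mc).
  by move: (modulus c) (1 - _) (eta - delta) => r r1 r2 r0; field.
apply: (@le_trans _ _ (modulus (1 - ce) * (modulus alpha * enorm de))).
  apply: ler_pM => //; first by rewrite subr_ge0 ltW.
  by rewrite !mulr_ge0 ?modulus_ge0 ?enorm_ge0 // subr_ge0 ltW.
rewrite mulrA [modulus (1 - ce) * _]mulrC -cE'.
apply: (le_trans (ler_wpM2l _ deb)); first by rewrite !mulr_ge0 ?modulus_ge0.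
by rewrite -/e -!mulrA [delta * _]mulrC -!mulrA.
Qed.

End ObliqueDecomposition.

(** * Scalar estimates behind the threshold *)

(** Here q is 1 - eps, c is the Rayleigh-Ritz constant, e and delta are the Ritz vector and Ritz
    value errors, and r is the new angle. *)
Lemma contraction_arith (R : realFieldType) (q eta kappa M c rho e delta r : R) :
  0 < q -> 0 < eta -> 1 <= kappa -> 0 < M -> 1 <= c -> q * eta <= M ->
  0 < rho -> rho < q * eta / (16 * kappa * M * c ^+ 2) ->
  0 <= e -> e <= c * rho -> 0 <= delta -> q * (1 - e) * delta <= M * e ->
  [/\ delta < eta, kappa * e < 1
    & (eta - delta) * (1 - kappa * e) * r <= 2 * kappa * e * delta ->
      r < rho ^+ 2 / (q * eta / (16 * kappa * M * c ^+ 2))].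
Proof.
move=> q0 eta0 k1 M0 c1 qM rho0 rhoS e0 ec d0 qd.
have k0 : 0 < kappa by lra.
have c0 : 0 < c by lra.
have D0 : 0 < 16 * kappa * M * c ^+ 2 by rewrite !mulr_gt0 // exprn_gt0.
have qe0 : 0 < q * eta by exact: mulr_gt0.
have kM0 : 0 < kappa * M by exact: mulr_gt0.
move: rhoS; rewrite ltr_pdivlMr // => rhoS.
(* The master smallness bound: e <= c rho <= c^2 rho. Dividing by M >= q eta, or dropping kappa >=
   1, gives the next two. *)
have kMe : 16 * (kappa * M * e) < q * eta.
  apply: le_lt_trans rhoS.
  have -> : rho * (16 * kappa * M * c ^+ 2) = 16 * (kappa * M * (c * (c * rho))) by ring.
  rewrite ler_pM2l // ler_pM2l //; apply: (le_trans ec).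
  by rewrite ler_peMl // ltW // mulr_gt0.
have ke : 16 * (kappa * e) < 1.
  by rewrite -(ltr_pM2r M0) mul1r; apply: le_lt_trans (lt_le_trans kMe qM); lra.
have Me : 16 * (M * e) < q * eta.
  apply: le_lt_trans kMe; rewrite ler_pM2l // -mulrA ler_peMl //.
  by rewrite mulr_ge0 // ltW.
have ee : e <= kappa * e by rewrite ler_peMl.
have qd0 : 0 <= q * delta by rewrite mulr_ge0 // ltW.
have qd' : 15 * (q * delta) <= 16 * (M * e).
  have : q * delta * (16 * e) <= q * delta * 1 by rewrite ler_wpM2l //; lra.
  lra.
have dd : 15 * delta < eta by rewrite -(ltr_pM2l q0); lra.
split; [lra|lra|move=> hr].
rewrite invf_div mulrA ltr_pdivlMr //.
have ke0 : 0 <= kappa * e by lra.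
have rho2 : 0 < kappa * M * (c * rho) ^+ 2 by rewrite mulr_gt0 // exprn_gt0 // mulr_gt0.
have -> : rho ^+ 2 * (16 * kappa * M * c ^+ 2) = 16 * (kappa * M * (c * rho) ^+ 2) by ring.
have [r0|r0] := lerP r 0.
  apply: (@le_lt_trans _ _ 0); last by rewrite mulr_gt0.
  by rewrite mulr_le0_ge0 // ltW.
have er0 : 0 < eta * r by exact: mulr_gt0.
(* From eta - delta >= 14/15 eta and 1 - kappa e >= 15/16, whose product is 7/8 eta. *)
have h1 : 7 * (eta * r) <= 16 * (kappa * e * delta).
  have a1 : (14 * eta) * (15 * r) <= (15 * (eta - delta)) * (16 * (1 - kappa * e) * r).
    by apply: ler_pM; [lra|lra|lra|rewrite ler_pM2r //; lra].
  lra.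
have h2 : q * (kappa * e * delta) * 15 <= 16 * (kappa * M * e ^+ 2).
  have : kappa * e * (15 * (q * delta)) <= kappa * e * (16 * (M * e)) by rewrite ler_wpM2l.
  lra.
have h3 : kappa * M * e ^+ 2 <= kappa * M * (c * rho) ^+ 2.
  by rewrite ler_pM2l // ler_pXn2r // nnegrE ltW // mulr_gt0.
(* Chained with [h2] this yields 105 q eta r <= 256 kappa M e^2; since 256/105 < 16, strictness
   follows from [rho2]. *)
have : q * (7 * (eta * r)) <= q * (16 * (kappa * e * delta)) by rewrite ler_pM2l.
lra.
Qed.

(** * Estimates for a single step *)

Section Step.
Variables (R : realType) (n k s p q : nat) (A : 'M[R[i]]_n).
Variables (lambda : R[i]) (xR xL : 'cV[R[i]]_n) (X : 'M[R[i]]_(n, k)).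
Variables (eta eps beta : R) (S : 'M[R[i]]_(s, n)).
Variables (V : 'M[R[i]]_(n, p.+1)) (V' : 'M[R[i]]_(n, q.+1)).
Variables (theta : R[i]) (y : 'cV[R[i]]_p.+1) (t : 'cV[R[i]]_n).
Local Notation kappa := (1 / modulus ((xL^t* *m xR) 0 0)).
Local Notation nu := (enorm ((A^t* - (lambda^*)%:M) *m xR)).
Local Notation N := (spectral_norm (A - lambda%:M)).
Local Notation M := (nu + (1 + eps) * N).
Local Notation CRR :=
  (Num.sqrt (1 + (1 + eps) / (1 - eps) * N ^+ 2 / beta ^+ 2)).
Local Notation rho_star := ((1 - eps) * eta / (16 * kappa * M * CRR ^+ 2)).

Hypothesis trip : eigentriplet A lambda xR xL.
Hypothesis xR1 : enorm xR = 1.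
Hypothesis xL1 : enorm xL = 1.
Hypothesis Xbasis : orthonormal_basis_of X (orthogonal_to xL).
Hypothesis sepA : sep lambda (X^t* *m A *m X) = eta%:E.
Hypothesis eta0 : 0 < eta.
Hypothesis eps01 : 0 < eps < 1.
Hypothesis beta0 : 0 < beta.
Hypothesis Vorth : sketch_orthonormal S V.
Hypothesis VV' : rjd_step S A V theta y t V'.
Hypothesis thl : theta <> lambda.
Hypothesis embS : subspace_embedding S eps (colspan (row_mx V (A *m V))).
Hypothesis sepH : separated S A lambda beta V theta y.

Lemma rjd_step_ritz_angle : sin_angle xR (V *m y) <= CRR * sin_angle xR V.
Proof.
case: trip => _ _ _ Ax _.
have [a ha] := rayleigh_ritz Vorth Ax eps01 embS xR1 beta0 sepH.
apply: le_trans ha; have -> : V *m (a *: y) = V *m y *m a%:M.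
  by rewrite mul_mx_scalar scalemxAr.
exact: sin_angle_le.
Qed.

Lemma rjd_step_contraction : 0 < rho_star -> sin_angle xR V < rho_star ->
  sin_angle xR V' < sin_angle xR V ^+ 2 / rho_star.
Proof.
move=> rhoS0 rhoS; case: trip => _ _ _ Ax xLA.
case: VV' => -[Hy y1] corr [_ V'E _ _].
have /andP[eps0 eps1] := eps01.
have q0 : 0 < 1 - eps by rewrite subr_gt0.
have xLx : (xL^t* *m xR) 0 0 != 0.
  apply: contraTneq rhoS0 => ->.
  by rewrite {1}/modulus normr0 invr0 !mulr0 !mul0r invr0 mulr0 ltxx.
have kappa1 := condition_ge1 xR1 xL1 xLx.
have etaN := sep_le_spectral_norm xLA Xbasis eta0 sepA.
have N0 : 0 <= N by exact: spectral_norm_ge0.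
have nu0 : 0 <= nu by exact: enorm_ge0.
have MN : (1 + eps) * N <= M by rewrite lerDr.
have etaM : eta <= M.
  apply: le_trans MN; apply: (le_trans etaN).
  by rewrite ler_peMl // lerDl ltW.
have qetaM : (1 - eps) * eta <= M.
  by apply: le_trans etaM; rewrite ler_piMl ?(ltW eta0) // gerBl ltW.
have CRR1 : 1 <= CRR.
  rewrite -[leLHS]sqrtr1 ler_wsqrtr // lerDl divr_ge0 ?sqr_ge0 //.
  by rewrite mulr_ge0 ?sqr_ge0 // divr_ge0 ?(ltW q0) // addr_ge0 ?(ltW eps0).
have rho0 := sin_angle_gt0 Vorth Ax eps01 embS xR1 beta0 (conj Hy y1) sepH thl.
have [a ha] := rayleigh_ritz Vorth Ax eps01 embS xR1 beta0 sepH.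
have dl := ritz_value_error Vorth Ax eps01 embS (conj Hy y1) a.
have hu := embedding_enorm_le Vorth eps01 embS y.
move: ha dl; rewrite -scalemxAr; set u := V *m y in hu corr *.
set e := enorm (xR - a *: u); set delta := modulus (theta - lambda) => ha dl.
have e0 : 0 <= e by exact: enorm_ge0.
have delta0 : 0 <= delta by exact: modulus_ge0.
(* As 1 - e <= |a| |u| and sqrt(1 - eps) |u| <= 1, one gets sqrt(1 - eps) (1 - e) <= |a|. The Ritz
   value bound controls |a| delta, and the remaining sqrt(1 - eps) is enlarged to sqrt(1 + eps). *)
have qd : (1 - eps) * (1 - e) * delta <= M * e.
  rewrite y1 in hu; have au : 1 - e <= modulus a * enorm u.
    rewrite lerBlDr -enormZ -{1}xR1 addrC -{1}(subrK (a *: u) xR).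
    exact: enormD.
  set sq := Num.sqrt (1 - eps) in hu; set h := Num.sqrt (1 + eps) in dl.
  have sq0 : 0 <= sq by exact: sqrtr_ge0.
  have h0 : 0 <= h by exact: sqrtr_ge0.
  have sqh : sq <= h by rewrite ler_wsqrtr // lerD2l; lra.
  have hh : h * h = 1 + eps by rewrite -expr2 sqr_sqrtr // addr_ge0 ?(ltW eps0).
  have -> : 1 - eps = sq * sq by rewrite -expr2 sqr_sqrtr // ltW.
  have a0 : 0 <= modulus a by exact: modulus_ge0.
  apply: (@le_trans _ _ (sq * (modulus a * delta))).
    have -> : sq * (modulus a * delta) = sq * 1 * modulus a * delta by ring.
    rewrite ler_wpM2r //.
    apply: (@le_trans _ _ (sq * sq * (modulus a * enorm u))).
      by rewrite ler_wpM2l // mulr_ge0.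
    have -> : sq * sq * (modulus a * enorm u) = sq * (sq * enorm u) * modulus a by ring.
    by rewrite ler_wpM2r // ler_wpM2l.
  apply: (@le_trans _ _ ((1 + eps) * N * e)); last by rewrite ler_wpM2r.
  rewrite -hh -!mulrA; apply: ler_pM => //; first by rewrite mulr_ge0.
  by rewrite mulrA.
have M0 : 0 < M by exact: lt_le_trans etaM.
have [dl1 ke concl] := contraction_arith (sin_angle xR V') q0 eta0 kappa1 M0 CRR1
  qetaM rho0 rhoS e0 ha delta0 qd.
have Su1 : enorm (S *m u) = 1 by rewrite /u enorm_sketch.
have [w0 [alpha wE]] := correction_inverse_iteration Su1 corr.
have [b hb] := inverse_iteration_contraction Ax xLA xR1 xL1 Xbasis xLx eta0 sepA
  thl dl1 ke w0 wE.
apply: (concl (le_trans _ hb)); apply: ler_wpM2l.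
  by apply: mulr_ge0; rewrite subr_ge0 ltW.
(* The inverse iterate has coordinates (y, 1) in [V, t], so the new subspace does at least as well
   as it. *)
have [c _ cE] : colspan V' (u + t).
  by rewrite V'E; exists (col_mx y 1%:M) => //; rewrite mul_row_col mulmx1.
by rewrite -cE scalemxAr sin_angle_le.
Qed.

End Step.

(** * Induction over the steps and quadratic convergence *)

Theorem theorem4p7 (R : realType) (n s : nat) (A : 'M[R[i]]_n)
    (lambda : R[i]) (xR xL : 'cV[R[i]]_n) (Xp : 'M[R[i]]_(n, n.-1))
    (eta eps beta : R) (S : 'M[R[i]]_(s, n))
    (steps : set nat) (p : nat -> nat)
    (V : forall m, 'M[R[i]]_(n, (p m).+1)) (theta : nat -> R[i])
    (y : forall m, 'cV[R[i]]_(p m).+1) (t : nat -> 'cV[R[i]]_n) :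
  let A22 := Xp^t* *m A *m Xp in
  let kappa := 1 / modulus ((xL^t* *m xR) 0 0) in
  let nu := enorm ((A^t* - (lambda^*)%:M) *m xR) in
  let normAl := spectral_norm (A - lambda%:M) in
  let K := (1 + eps) / (1 - eps) in
  let M := nu + (1 + eps) * normAl in
  let CRR := Num.sqrt (1 + K * normAl ^+ 2 / beta ^+ 2) in
  let rho_star := (1 - eps) * eta / (16 * kappa * M * CRR ^+ 2) in
  let rho := fun m => sin_angle xR (V m) in
  let sr := fun m => sin_angle xR (V m *m y m) in
  eigentriplet A lambda xR xL ->
  enorm xR = 1 ->
  enorm xL = 1 ->
  orthonormal_basis_of Xp (orthogonal_to xL) ->
  sep lambda A22 = eta%:E ->
  0 < eta ->
  0 < eps < 1 ->
  0 < beta ->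
  (* the steps performed form an initial segment of nat, possibly all of it *)
  (forall m, steps m.+1 -> steps m) ->
  sketch_orthonormal S (V 0%N) ->
  (forall m, steps m -> rjd_step S A (V m) (theta m) (y m) (t m) (V m.+1)) ->
  (forall m, steps m -> theta m <> lambda) ->
  (forall m, steps m ->
    subspace_embedding S eps (colspan (row_mx (V m) (A *m V m)))) ->
  (forall m, steps m -> separated S A lambda beta (V m) (theta m) (y m)) ->
  rho 0%N < rho_star ->
  [/\ forall m, steps m -> rho m.+1 < rho m ^+ 2 / rho_star,
      forall m, steps m -> sr m <= CRR * rho m,
      forall m, steps m.+1 -> sr m.+1 < CRR / rho_star * sr m ^+ 2
    & (forall m, steps m) ->
        quadratic_convergence_to_0 rho /\ quadratic_convergence_to_0 sr].
Proof.
move=> A22 kappa nu normAl K M CRR rho_star rho sr trip xR1 xL1 Xbasis sepA eta0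
  eps01 beta0 stepsS V0 step thl embS sepH rhoS0.
have rho_ge0 m : 0 <= rho m by exact: sin_angle_ge0.
have rhoS : 0 < rho_star by exact: le_lt_trans rhoS0.
have rhoSV : 0 < rho_star^-1 by rewrite invr_gt0.
have CRR0 : 0 <= CRR by exact: sqrtr_ge0.
have Vorth m : steps m -> sketch_orthonormal S (V m).
  by case: m => // m /stepsS/step[_ _ []].
have contract m : steps m -> rho m < rho_star -> rho m.+1 < rho m ^+ 2 / rho_star.
  by move=> mS; apply: (rjd_step_contraction trip xR1 xL1 Xbasis sepA eta0 eps01
    beta0 (Vorth m mS) (step m mS) (thl m mS) (embS m mS) (sepH m mS)).
have geom m : steps m -> rho m < rho_star -> rho m.+1 <= rho m * (rho m / rho_star).
  by move=> mS rm; rewrite mulrA -expr2 ltW ?contract.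
(* Propagates the threshold condition that each contraction requires: below [rho_star] the factor
   rho m / rho_star is less than 1. *)
have rho_small m : steps m -> rho m <= rho 0%N.
  elim: m => [//|m IH] /stepsS mS; have rm := IH mS.
  have rS := le_lt_trans rm rhoS0.
  apply: (le_trans (geom m mS rS)); apply: le_trans rm.
  by rewrite ler_piMr // ler_pdivrMr // mul1r ltW.
have rho_lt m (mS : steps m) : rho m < rho_star := le_lt_trans (rho_small m mS) rhoS0.
have ritz m : steps m -> sr m <= CRR * rho m.
  move=> mS; case: (step m mS) => Hy _ _.
  exact: (rjd_step_ritz_angle trip xR1 eps01 beta0 (Vorth m mS) (embS m mS) (sepH m mS)).
have rho_sr m : rho m <= sr m by exact: sin_angle_mul.
have sr_ge0 m : 0 <= sr m by exact: sin_angle_ge0.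
(* A zero [CRR] would make [rho_star] zero, by x / 0 = 0. *)
have CRRgt0 m : steps m -> 0 < CRR.
  move=> mS; rewrite lt0r CRR0 andbT; apply/eqP => C0.
  by move: rhoS; rewrite /rho_star C0 expr0n mulr0 invr0 mulr0 ltxx.
(* Pass from the Ritz angle to the subspace angle, contract, and return by rho m <= sr m; a Ritz
   vector at m.+1 presupposes that this step is performed. *)
have ritz_contract m : steps m.+1 -> sr m.+1 < CRR / rho_star * sr m ^+ 2.
  move=> mS; apply: (le_lt_trans (ritz _ mS)); rewrite -mulrA ltr_pM2l ?(CRRgt0 _ mS) //.
  apply: (lt_le_trans (contract m (stepsS m mS) (rho_lt m (stepsS m mS)))).
  by rewrite mulrC ler_pM2l // ler_pXn2r ?nnegrE.
split => [m mS|//|//|all_steps]; first exact: contract (rho_lt m mS).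
(* A geometric majorant of ratio r < 1 suffices for convergence to 0. *)
set r := rho 0%N / rho_star.
have r0 : 0 <= r by rewrite divr_ge0 // ltW.
have r1 : r < 1 by rewrite ltr_pdivrMr // mul1r.
have rho_geom m : rho m <= rho 0%N * r ^+ m.
  elim: m => [|m IH]; first by rewrite expr0 mulr1.
  rewrite exprSr mulrA; apply: (le_trans (geom m (all_steps m) (rho_lt m (all_steps m)))).
  apply: ler_pM => //; first by rewrite divr_ge0 // ltW.
  by rewrite ler_pM2r // rho_small.
have geom0 c : (fun m => c * r ^+ m) @ \oo --> (0 : R).
  by apply: cvg_geometric; rewrite ger0_norm.
have rho_cvg : rho @ \oo --> (0 : R).
  apply: (@squeeze_cvgr _ _ _ _ (fun=> 0) (fun m => rho 0%N * r ^+ m)) => //.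
  - by near=> m; rewrite rho_ge0 rho_geom.
  - exact: cvg_cst.
split; split => //.
- by exists rho_star^-1 => m; rewrite [leRHS]mulrC ltW // contract // rho_lt.
- apply: (@squeeze_cvgr _ _ _ _ (fun=> 0) (fun m => CRR * rho m)).
  + by near=> m; rewrite sr_ge0 ritz.
  + exact: cvg_cst.
  + by have := cvgM (cvg_cst CRR) rho_cvg; rewrite mulr0; apply.
- by exists (CRR / rho_star) => m; rewrite ltW // ritz_contract.
Unshelve. all: by end_near. Qed.
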